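(* Let $K$ be a field, let $n\ge 1$ and let $k$ be an integer with $n>k\geq\lfloor\frac{n}{2}\rfloor$. Let $R=K[X_1,\dots,X_n]$ and let $M(n,k)$ be the $k$-th syzygy module of the residue class field $K=R/(X_1,\dots,X_n)$, i.e. the $k$-th syzygy module in the Koszul complex. Then $$\operatorname{sdepth} M(n,k)=n-1,$$ where $\operatorname{sdepth}$ denotes the Stanley depth with respect to the $\mathbb{Z}^n$-grading.
   Context: $R=K[X_1,\dots,X_n]$ carries the $\mathbb{Z}^n$-grading with $\deg(X_i)=\mathbf e_i$, the $i$-th unit vector; ''graded'' and ''homogeneous'' refer to this multigrading. The Koszul complex $0\to\bigwedge^n R^n\to\bigwedge^{n-1}R^n\to\dots\to R^n\to R\to 0$ with differential $$\partial(e_{i_1}\wedge\dots\wedge e_{i_k})=\sum_{j=1}^{k}(-1)^{j+1}X_j' \,e_{i_1}\wedge\dots\wedge\widehat{e_{i_j}}\wedge\dots\wedge e_{i_k},\qquad X_j'=X_{i_j},$$ is a minimal free resolution of $K=R/(X_1,\dots,X_n)$; it is $\mathbb{Z}^n$-graded with $e_{i_1}\wedge\dots\wedge e_{i_k}$ of degree $\mathbf e_{i_1}+\dots+\mathbf e_{i_k}$ for $i_1<\dots<i_k$. $M(n,k)$ is the image of the $k$-th boundary map $\partial:\bigwedge^kR^n\to\bigwedge^{k-1}R^n$ for $k\ge 1$, and $M(n,0)=K$ (the case $k=0$ occurs only for $n=1$). Let $M$ be a finitely generated graded $R$-module. For a homogeneous element $m\in M$ and $Z\subseteq\{X_1,\dots,X_n\}$,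 $K[Z]m$ is called a Stanley space of $M$ if it is a free $K[Z]$-submodule of $M$. A Stanley decomposition $\mathcal D=(K[Z_i],m_i)_{i\in I}$ of $M$ is a finite decomposition $M=\bigoplus_{i\in I}K[Z_i]m_i$ as a graded $K$-vector space in which every $K[Z_i]m_i$ is a Stanley space of $M$. The direct sum $\bigoplus_i K[Z_i]m_i$ is regarded as an $R$-module (variables outside $Z_i$ act as $0$ on the $i$-th summand), and $\operatorname{depth}\mathcal D$ is its depth, i.e. $\min_{i}|Z_i|$. The Stanley depth is $$\operatorname{sdepth} M=\max\{\operatorname{depth}\mathcal D\mid \mathcal D \text{ is a Stanley decomposition of } M\}.$$ *)

(* Defs.v *)
From HB Require Import structures.
From mathcomp Require Import all_boot all_order all_algebra.
From mathcomp Require Import boolp.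
From mathcomp Require Import mpoly.

Set Implicit Arguments.
Unset Strict Implicit.
Unset Printing Implicit Defensive.

Import GRing.Theory.
Local Open Scope ring_scope.

(* Finitely generated Z^n-graded modules over R = K[X_1, ..., X_n].  The      *)
(* variables are indexed by 'I_n, degrees live in 'rV[int]_n, and             *)
(* [ghom M a x] means that x lies in the homogeneous component M_a.           *)
Record gradedModule (K : fieldType) (n : nat) := GradedModule {
  gsort :> lmodType {mpoly K[n]};
  ghom : 'rV[int]_n -> gsort -> Prop;
  ghom0 : forall a, ghom a 0;
  ghomD : forall a x y, ghom a x -> ghom a y -> ghom a (x + y);
  ghomC : forall a (c : K) x, ghom a x -> ghom a (c%:MP *: x);
  ghomX : forall a i x, ghom a x -> ghom (a + delta_mx 0 i) ('X_i *: x);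
  (* M is the direct sum of its homogeneous components *)
  gspan : forall x, exists2 s : seq gsort,
    {in s, forall y, exists a, ghom a y} & x = \sum_(y <- s) y;
  gdirect : forall (s : seq 'rV[int]_n) (y : 'rV[int]_n -> gsort),
    uniq s -> (forall a, ghom a (y a)) -> \sum_(a <- s) y a = 0 ->
    {in s, forall a, y a = 0};
  gfg : exists r (g : 'I_r -> gsort), forall x,
    exists c : 'I_r -> {mpoly K[n]}, x = \sum_j c j *: g j
}.

Section StanleyDepth.

Variables (K : fieldType) (n : nat).
Implicit Types (M : gradedModule K n) (Z : {set 'I_n}) (p : {mpoly K[n]}).

(* p \in K[Z] *)
Definition poly_in Z p : Prop :=
  forall u, u \in msupp p -> forall i, i \notin Z -> u i = 0%N.

(* x \in K[Z]m *)
Definition cyclic_span M Z (m x : M) : Prop :=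
  exists2 p, poly_in Z p & x = p *: m.

(* m is homogeneous and K[Z]m is K[Z]-free with basis m; so m != 0. *)
Definition stanley_space M Z (m : M) : Prop :=
  (exists a, ghom a m) /\ (forall p, poly_in Z p -> p *: m = 0 -> p = 0).

Record stanley_family M := StanleyFamily {
  sf_size : nat;
  sf_set : 'I_sf_size -> {set 'I_n};
  sf_gen : 'I_sf_size -> M
}.
Arguments sf_set {M} D i : rename.
Arguments sf_gen {M} D i : rename.

(* Since the sf_gen i are homogeneous, the summands are graded subspaces, so  *)
(* a decomposition of M as a K-vector space is one of graded vector spaces.   *)
Definition stanley_decomposition M (D : stanley_family M) : Prop :=
  (forall i, stanley_space (sf_set D i) (sf_gen D i)) /\
  (forall x : M, exists! y : {ffun 'I_(sf_size D) -> M},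
     (forall i, cyclic_span (sf_set D i) (sf_gen D i) (y i)) /\
     x = \sum_i y i).

(* The minimum of the #|Z_i|, which are at most n; the neutral element n is   *)
(* only reached by default for the empty family, i.e. for M = 0.              *)
Definition stanley_family_depth M (D : stanley_family M) : nat :=
  \big[minn/n]_(i < sf_size D) #|sf_set D i|.

(* sdepth M = d: the maximum over all Stanley decompositions exists and is d. *)
Definition sdepth_is M (d : nat) : Prop :=
  (exists2 D : stanley_family M,
     stanley_decomposition D & stanley_family_depth D = d) /\
  (forall D : stanley_family M,
     stanley_decomposition D -> (stanley_family_depth D <= d)%N).

End StanleyDepth.

Section Residue.

Variables (K : fieldType) (n : nat).

(* K = R/(X_1, ..., X_n) as an R-module: the variables act as 0. *)
Definition residue_field : Type := (fun _ : nat => K : Type) n.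
HB.instance Definition _ := GRing.Zmodule.copy residue_field K.

Definition residue_scale (p : {mpoly K[n]}) (c : residue_field) :
  residue_field := p.@[fun=> 0] * (c : K).

Fact residue_scaleA p q c :
  residue_scale p (residue_scale q c) = residue_scale (p * q) c.
Proof. by rewrite /residue_scale mevalM mulrA. Qed.

Fact residue_scale1 : left_id 1 residue_scale.
Proof. by move=> c; rewrite /residue_scale meval1 mul1r. Qed.

Fact residue_scaleDr : right_distributive residue_scale +%R.
Proof. by move=> p c d; rewrite /residue_scale mulrDr. Qed.

Fact residue_scaleDl c : {morph residue_scale^~ c : p q / p + q}.
Proof. by move=> p q; rewrite /residue_scale mevalD mulrDl. Qed.

HB.instance Definition _ := GRing.Zmodule_isLmodule.Build {mpoly K[n]}
  residue_field residue_scaleA residue_scale1 residue_scaleDr residue_scaleDl.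

Definition residue_hom (a : 'rV[int]_n) (c : residue_field) : Prop :=
  a != 0 -> c = 0.

Fact residue_hom0 a : residue_hom a 0. Proof. by []. Qed.

Fact residue_homD a x y :
  residue_hom a x -> residue_hom a y -> residue_hom a (x + y).
Proof. by move=> hx hy a0; rewrite hx // hy // addr0. Qed.

Fact residue_homC a (c : K) x : residue_hom a x -> residue_hom a (c%:MP *: x).
Proof. by move=> hx a0; rewrite hx // scaler0. Qed.

Fact residue_homX a i x :
  residue_hom a x -> residue_hom (a + delta_mx 0 i) ('X_i *: x).
Proof. by move=> _ _; rewrite /GRing.scale /= /residue_scale mevalXU mul0r. Qed.

Fact residue_span (x : residue_field) : exists2 s : seq residue_field,
  {in s, forall y, exists a, residue_hom a y} & x = \sum_(y <- s) y.
Proof.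
exists [:: x]; last by rewrite big_seq1.
by move=> y _; exists 0; rewrite /residue_hom eqxx.
Qed.

Fact residue_direct (s : seq 'rV[int]_n) (y : 'rV[int]_n -> residue_field) :
  uniq s -> (forall a, residue_hom a (y a)) -> \sum_(a <- s) y a = 0 ->
  {in s, forall a, y a = 0}.
Proof.
move=> us hy sum0 a; have [-> s0|/hy//] := eqVneq a 0.
move: sum0; rewrite (bigD1_seq 0) //= big1 ?addr0 // => b b0; exact: hy.
Qed.

Fact residue_fg : exists r (g : 'I_r -> residue_field), forall x,
  exists c : 'I_r -> {mpoly K[n]}, x = \sum_j c j *: g j.
Proof.
exists 1%N, (fun=> (1 : K)) => x; exists (fun=> (x : K)%:MP).
by rewrite big_ord1 /GRing.scale /= /residue_scale mevalC mulr1.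
Qed.

Definition residue_module : gradedModule K n :=
  GradedModule residue_hom0 residue_homD residue_homC residue_homX
    residue_span residue_direct residue_fg.

End Residue.

Section Koszul.

Variables (K : fieldType) (n : nat).

(* The exterior algebra of R^n as the free R-module on the basis e_S, for S a *)
(* subset of 'I_n, where e_S = e_(i_1) /\ ... /\ e_(i_k) if                   *)
(* S = {i_1 < ... < i_k}.                                                     *)
Definition exterior := {ffun {set 'I_n} -> {mpoly K[n]}^o}.
HB.instance Definition _ := GRing.Lmodule.on exterior.

Definition ext_basis (S : {set 'I_n}) : exterior :=
  [ffun T => ((T == S)%:R : {mpoly K[n]})].

(* If i = i_j in S, then j - 1 is the number of elements of S below i, so the *)
(* sign below is (-1)^(j + 1).                                                *)
Definition koszul_basis_diff (S : {set 'I_n}) : exterior :=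
  \sum_(i in S)
    ((-1) ^+ #|[set j in S | (j < i)%N]| * 'X_i) *: ext_basis (S :\ i).

Definition koszul_diff (v : exterior) : exterior :=
  \sum_(S : {set 'I_n}) (v S : {mpoly K[n]}) *: koszul_basis_diff S.

(* The k-th exterior power of R^n inside the exterior algebra. *)
Definition ext_power (k : nat) (v : exterior) : Prop :=
  forall S : {set 'I_n}, #|S| != k -> v S = 0.

Definition koszul_image (k : nat) : {pred exterior} :=
  fun w => `[< exists2 v, ext_power k v & w = koszul_diff v >].

(* The degree of X^u e_S. *)
Definition ext_deg (u : 'X_{1..n}) (S : {set 'I_n}) : 'rV[int]_n :=
  \row_i ((u i + (i \in S))%N : int).

Definition ext_hom (a : 'rV[int]_n) (w : exterior) : Prop :=
  forall S u, u \in msupp (w S) -> ext_deg u S = a.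

Fact koszul_diff_linear : linear koszul_diff.
Proof.
move=> p v w; rewrite /koszul_diff scaler_sumr -big_split /=.
by apply: eq_bigr => S _; rewrite !ffunE scalerDl scalerA.
Qed.

HB.instance Definition _ :=
  GRing.isLinear.Build {mpoly K[n]} exterior exterior _ koszul_diff
    koszul_diff_linear.

Fact koszul_image_submod k : submod_closed (koszul_image k).
Proof.
split=> [|p x y /asboolP[v hv ->] /asboolP[w hw ->]]; apply/asboolP.
  by exists 0; [move=> S _; rewrite ffunE | rewrite linear0].
exists (p *: v + w); last by rewrite linearP.
by move=> S hS; rewrite !ffunE hv // hw // scaler0 addr0.
Qed.

HB.instance Definition _ k :=
  GRing.isSubmodClosed.Build {mpoly K[n]} exterior (koszul_image k)
    (koszul_image_submod k).

Record koszul_syz k :=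
  KoszulSyz { koszul_syz_val : exterior; _ : koszul_syz_val \in koszul_image k }.
HB.instance Definition _ k := [isSub for @koszul_syz_val k].
HB.instance Definition _ k := [Choice of koszul_syz k by <:].
HB.instance Definition _ k :=
  [SubChoice_isSubLmodule of koszul_syz k by <:].

Definition koszul_syz_hom k (a : 'rV[int]_n) (x : koszul_syz k) : Prop :=
  ext_hom a (val x).

Fact ext_hom0 a : ext_hom a 0.
Proof. by move=> S u; rewrite ffunE msupp0. Qed.

Fact ext_homD a x y : ext_hom a x -> ext_hom a y -> ext_hom a (x + y).
Proof.
move=> hx hy S u; rewrite ffunE => /msuppD_le; rewrite mem_cat.
by case/orP => [/hx|/hy].
Qed.

Fact ext_homC a (c : K) x : ext_hom a x -> ext_hom a (c%:MP *: x).
Proof.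
move=> hx S u; rewrite ffunE /GRing.scale /= mul_mpolyC.
by move=> /msuppZ_le /hx.
Qed.

Fact ext_homX a i x : ext_hom a x -> ext_hom (a + delta_mx 0 i) ('X_i *: x).
Proof.
move=> hx S u; rewrite ffunE /GRing.scale /= => /msuppM_le.
rewrite msuppX => /allpairsP[[u1 u2]] /= [].
rewrite inE => /eqP-> /hx <- ->; apply/rowP=> j.
by rewrite !mxE mnmDE mnm1E eqxx /= eq_sym -addnA addnC PoszD natz.
Qed.

Fact ext_hom_sum a (I : Type) (r : seq I) (P : pred I) (F : I -> exterior) :
  (forall i, P i -> ext_hom a (F i)) -> ext_hom a (\sum_(i <- r | P i) F i).
Proof. by move=> hF; apply: big_ind => //; [exact: ext_hom0|exact: ext_homD]. Qed.

Fact ext_homXm u x a :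
  ext_hom a x -> exists b, ext_hom b ('X_[u] *: x).
Proof.
move=> hx; exists (a + \row_i (u i : int)) => S v.
rewrite ffunE /GRing.scale /= => /msuppM_le.
rewrite msuppX => /allpairsP[[u1 u2]] /= [].
rewrite inE => /eqP-> /hx <- ->; apply/rowP=> j.
by rewrite !mxE mnmDE -addnA addnC PoszD.
Qed.

Fact koszul_basis_diff_hom S : ext_hom (ext_deg 0 S) (koszul_basis_diff S).
Proof.
apply: ext_hom_sum => i iS.
have -> : ext_deg 0 S = ext_deg 0 (S :\ i) + delta_mx 0 i.
  apply/rowP=> j; rewrite !mxE !mnm0E eqxx /= !inE.
  by have [->|] := eqVneq j i; rewrite ?iS ?addr0.
have -> m : (-1) ^+ m * 'X_i = ((-1) ^+ m : K)%:MP * 'X_i :> {mpoly K[n]}.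
  by rewrite rmorphXn /= rmorphN1.
rewrite -scalerA.
apply: ext_homC; apply: ext_homX => T u; rewrite ffunE.
by have [->|_] := eqVneq T (S :\ i); rewrite ?msupp0 // msupp1 inE => /eqP->.
Qed.

Fact koszul_syz_hom0 k a : @koszul_syz_hom k a 0.
Proof. by rewrite /koszul_syz_hom raddf0; exact: ext_hom0. Qed.

Fact koszul_syz_homD k a (x y : koszul_syz k) :
  koszul_syz_hom a x -> koszul_syz_hom a y -> koszul_syz_hom a (x + y).
Proof. by rewrite /koszul_syz_hom raddfD; exact: ext_homD. Qed.

Fact koszul_syz_homC k a (c : K) (x : koszul_syz k) :
  koszul_syz_hom a x -> koszul_syz_hom a (c%:MP *: x).
Proof. by rewrite /koszul_syz_hom linearZ; exact: ext_homC. Qed.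

Fact koszul_syz_homX k a i (x : koszul_syz k) :
  koszul_syz_hom a x -> koszul_syz_hom (a + delta_mx 0 i) ('X_i *: x).
Proof. by rewrite /koszul_syz_hom linearZ; exact: ext_homX. Qed.

Fact koszul_gen_subproof k (S : {set 'I_n}) :
  koszul_diff (if #|S| == k then ext_basis S else 0) \in koszul_image k.
Proof.
apply/asboolP; eexists; last by [].
have [Sk|_] := eqVneq #|S| k => T Tk; last by rewrite ffunE.
rewrite ffunE; suff /negbTE -> : T != S by [].
by apply: contraNneq Tk => ->; rewrite Sk.
Qed.

Definition koszul_gen k (S : {set 'I_n}) : koszul_syz k :=
  KoszulSyz (koszul_gen_subproof k S).

Fact koszul_diff_basis S : koszul_diff (ext_basis S) = koszul_basis_diff S.
Proof.
rewrite /koszul_diff (bigD1 S) //= big1 => [|T TS].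
  by rewrite ffunE eqxx scale1r addr0.
by rewrite ffunE (negbTE TS) scale0r.
Qed.

Fact koszul_gen_hom k S : koszul_syz_hom (ext_deg 0 S) (koszul_gen k S).
Proof.
rewrite /koszul_syz_hom /=; case: ifP => _; last first.
  by rewrite linear0; exact: ext_hom0.
by rewrite koszul_diff_basis; exact: koszul_basis_diff_hom.
Qed.

Fact koszul_genP k (x : koszul_syz k) : exists c : {set 'I_n} -> {mpoly K[n]},
  x = \sum_S c S *: koszul_gen k S.
Proof.
case: x => w wP; have /asboolP[v hv wE] := wP.
exists v; apply: val_inj; rewrite raddf_sum [LHS]/= wE.
apply: eq_bigr => S _; rewrite -[RHS]/(val (v S *: koszul_gen k S)) linearZ /=.
have [_|/hv ->] := eqVneq #|S| k; last by rewrite !scale0r.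
by rewrite koszul_diff_basis.
Qed.

Fact koszul_syz_span k (x : koszul_syz k) : exists2 s : seq (koszul_syz k),
  {in s, forall y, exists a, koszul_syz_hom a y} & x = \sum_(y <- s) y.
Proof.
have [c ->] := koszul_genP x.
exists [seq ((c T)@_u)%:MP *: ('X_[u] *: koszul_gen k T)
         | T <- index_enum {set 'I_n}, u <- msupp (c T)].
  move=> y /allpairsPdep[S [u [_ _ ->]]].
  have [a ha] := ext_homXm u (@koszul_gen_hom k S).
  by exists a; apply: koszul_syz_homC; rewrite /koszul_syz_hom linearZ.
rewrite big_allpairs_dep /=; apply: eq_bigr => S _.
rewrite {1}[c S]mpolyE scaler_suml; apply: eq_bigr => u _.
by rewrite -mul_mpolyC scalerA.
Qed.

Fact ext_direct (s : seq 'rV[int]_n) (y : 'rV[int]_n -> exterior) :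
  uniq s -> (forall a, ext_hom a (y a)) -> \sum_(a <- s) y a = 0 ->
  {in s, forall a, y a = 0}.
Proof.
move=> us hy sum0 a sa; apply/ffunP=> S; rewrite ffunE; apply/mpolyP=> u.
rewrite mcoeff0; have [//|yu] := eqVneq (mcoeff u (y a S)) 0.
have ua : ext_deg u S = a by apply: hy; rewrite mcoeff_msupp.
have /(congr1 (fun w : exterior => mcoeff u (w S))) := sum0.
rewrite sum_ffunE ffunE mcoeff0 raddf_sum (bigD1_seq a) //= big1 ?addr0 //.
move=> b ba; apply: contraNeq ba; rewrite -mcoeff_msupp => /hy <-.
by rewrite ua.
Qed.

Fact koszul_syz_direct k (s : seq 'rV[int]_n) (y : 'rV[int]_n -> koszul_syz k) :
  uniq s -> (forall a, koszul_syz_hom a (y a)) -> \sum_(a <- s) y a = 0 ->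
  {in s, forall a, y a = 0}.
Proof.
move=> us hy sum0 a sa; apply: val_inj; rewrite raddf0.
apply: (@ext_direct s (fun b => val (y b))) => //.
by rewrite -raddf_sum sum0 raddf0.
Qed.

Fact koszul_syz_fg k : exists r (g : 'I_r -> koszul_syz k), forall x,
  exists c : 'I_r -> {mpoly K[n]}, x = \sum_j c j *: g j.
Proof.
exists #|{set 'I_n}|, (koszul_gen k \o enum_val) => x.
have [c ->] := koszul_genP x; exists (c \o enum_val).
by rewrite (reindex (@enum_val _ predT)) //=; exact/onW_bij/enum_val_bij.
Qed.

Definition koszul_syz_module k : gradedModule K n :=
  GradedModule (@koszul_syz_hom0 k) (@koszul_syz_homD k) (@koszul_syz_homC k)
    (@koszul_syz_homX k) (@koszul_syz_span k) (@koszul_syz_direct k)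
    (koszul_syz_fg k).

End Koszul.

(* M(n, k) *)
Definition syzygy (K : fieldType) (n k : nat) : gradedModule K n :=
  if k is 0 then residue_module K n else koszul_syz_module K n k.

(* Main.v *)
From HB Require Import structures.
Require Import Defs.
From mathcomp Require Import all_boot all_order all_algebra.
From mathcomp Require Import boolp mpoly zify ring.

(** Write g_S for the boundary of the basis element e_S of the Koszul complex,
    so that M(n, k) is generated by the g_S with S a k-subset of [n].

    Upper bound.  If every K[Z_i]m_i of a Stanley decomposition had Z_i = [n],
    then M(n, k) would be free with basis (m_i).  For a (k+1)-set T, the
    relation sum_(i in T) +-X_i g_(T - i) = 0 then holds coordinatewise, which
    forces the coordinates of every g_(T - i) to have no constant term.  As the
    m_i have entries in (X_1, ..., X_n), the entries of g_(T - i) would lie in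
    (X_1, ..., X_n)^2; but they are +-X_j.  (Lemma
    [stanley_generators_not_basis].)

    Lower bound.  In degree a with support A, the vector space M(n, k)_a is
    spanned by the monomial multiples of the g_S with S inside A, and depends
    only on A.  A Stanley decomposition with generators X^D g_S selects
    for each A a basis among these; the problem is to select the bases so that
    the degrees in which g_S is selected split into cones of dimension at
    least n - 1.

    The selection comes from the bracketing of subsets.  Read S as a path, with
    an up-step at the elements of S and a down-step elsewhere; the records of S
    are the down-steps reaching a new minimum.  Adding the last record z to
    S, when there is one, deletes z from the records and leaves the others
    unchanged (lemma [recordsU1]); write up S for the set obtained.  For a
    given A, count the records of S lying in A before the first one outside A,
    starting from the last: this is the run of S in A, and adding z in A lowers
    its length by one.  Call S even or odd in A according to the parity of that
    length.  The g_S with S an even k-subset of A form a basis in degree A: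

    - they span, because for S odd the relation for T = up S expresses g_S
      through the g_(T - i).  This rewriting terminates: if S' = T - i is odd
      again, then its last record is larger than i (lemma
      [odd_run_exchange]), so the sum of the elements of up S' exceeds that of
      up S (lemma [face_span]);

    - they are independent.  A dependency is a cycle c supported on even sets,
      hence the boundary of a chain b, and by the spanning statement for k + 1
      the chain b may be taken supported on even (k+1)-sets.  As 2(k + 1) > n,
      each of these is up S for some S (lemma [ex_up]), and S is then odd.  By
      the same termination order, if b were nonzero then the coefficient of c at
      some such S would be, up to sign, that of b at up S, although S is odd;
      so b = 0 (lemma [even_chain_cycle]).  This is where k >= n/2 enters.

    Finally, S is even in A exactly when the run D of S in A has even size; D
    is a set of last records of S, and the sets A with run D are those that
    contain S and D but not the last record outside D.  So g_S is selected in
    the disjoint union of the cones of the X^D g_S, with D a set of last records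
    of even size, in which at most one variable is left out. *)

Set Implicit Arguments.
Unset Strict Implicit.
Unset Printing Implicit Defensive.

Import GRing.Theory.

(** * Records and runs of a set *)

Section Records.

Variable n : nat.
Implicit Types (S T A D : {set 'I_n}) (p q z : 'I_n) (l : nat).

Definition below S l : nat := #|[set j in S | (j < l)%N]|.

Lemma belowU1 i S l : i \notin S -> below (i |: S) l = (i < l) + below S l.
Proof.
move=> iS; rewrite /below; case: ltnP => il /=.
  have -> : [set j in i |: S | j < l] = i |: [set j in S | j < l].
    by apply/setP=> j; rewrite !inE; have [->|] := eqVneq j i; rewrite ?il.
  by rewrite cardsU1 !inE (negbTE iS).
rewrite add0n; apply: eq_card => j; rewrite !inE.
by have [->|] := eqVneq j i; rewrite //= ltnNge il andbF.
Qed.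

Lemma belowS S p : below S p.+1 = (p \in S) + below S p.
Proof.
have [pS|pS] := boolP (p \in S).
  rewrite -(setD1K pS) !belowU1 ?setD11 // ltnSn ltnn !add0n; congr (_ + _).
  apply: eq_card => j; rewrite !inE ltnS leq_eqVlt.
  by have [/eqP|] := eqVneq (j : nat) p; rewrite ?(inj_eq val_inj) // => ->.
apply: eq_card => j; rewrite !inE ltnS leq_eqVlt.
by have [/val_inj ->|] := eqVneq (j : nat) p; rewrite ?(negbTE pS).
Qed.

Lemma below_all S : below S n = #|S|.
Proof. by apply: eq_card => j; rewrite inE ltn_ord andbT. Qed.

Lemma below0 S : below S 0 = 0.
Proof. by apply: eq_card0 => j; rewrite inE ltn0 andbF. Qed.

(** The path of S has height 2 * below S l - l after l steps; the inequality
    compares heights without subtraction. *)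
Definition records S : {set 'I_n} :=
  [set p : 'I_n | [forall l : 'I_n, (l <= p) ==>
     ((below S p.+1).*2 + l < (below S l).*2 + p.+1)]].

Lemma recordsP S p :
  reflect (forall l, l <= p -> (below S p.+1).*2 + l < (below S l).*2 + p.+1)
    (p \in records S).
Proof.
rewrite inE; apply: (iffP forallP) => h l.
  by move=> lp; have /implyP := h (Ordinal (leq_ltn_trans lp (ltn_ord p))); apply.
by apply/implyP; apply: h.
Qed.

Lemma records_notin S p : p \in records S -> p \notin S.
Proof.
move=> /recordsP/(_ p (leqnn _)); rewrite belowS; case: (p \in S) => //=; lia.
Qed.

Definition last_record S z := z \in records S /\ {in records S, forall q, q <= z}.

Lemma last_record_notin S z : last_record S z -> z \notin S.
Proof. by case=> /records_notin. Qed.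

Lemma last_record_uniq S z z' : last_record S z -> last_record S z' -> z = z'.
Proof.
by move=> [zS mz] [z'S mz']; apply/val_inj/anti_leq; rewrite mz' ?mz.
Qed.

Lemma ex_last_record S : records S != set0 -> exists z, last_record S z.
Proof.
case/set0Pn=> p pS.
by case: (arg_maxnP (fun p : 'I_n => p : nat) pS) => z zS mz; exists z.
Qed.

(** Otherwise the first step below the level reached at z would be a later
    record. *)
Lemma last_record_min S z l : last_record S z -> z < l <= n ->
  (below S z.+1).*2 + l <= (below S l).*2 + z.+1.
Proof.
move=> [/recordsP zS mz]; elim/ltn_ind: l => l IH /andP[zl ln].
case: l zl ln IH => // l zl ln IH.
rewrite leqNgt; apply/negP => hl.
suff /mz /= lz : Ordinal ln \in records S.
  by move: hl; have -> : l = z by [lia]; rewrite ltnn.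
apply/recordsP => /= l' l'l; have [l'z|zl'] := leqP l' z.
  by have := zS l' l'z; lia.
have := IH l'; rewrite ltnS l'l zl' /=; lia.
Qed.

(** Being a record at p depends only on the path up to p.  Adding i raises
    the path by 2 after i, so it creates no record after i, and there was none
    there.  The lemma applies both to the last record i of S and to an element
    i beyond all the records. *)
Lemma recordsU1 i S : i \notin S -> {in records S, forall q, q <= i} ->
  records (i |: S) = records S :\ i.
Proof.
move=> iS mi; apply/setP=> p; rewrite !in_setD1.
have [->|pi /=] := eqVneq p i.
  by apply/negP => /records_notin; rewrite setU11.
have {}pi : p <> i :> nat by move=> /val_inj/eqP; apply/negP.
apply/recordsP/recordsP => h l lp; move: (h l lp); rewrite !belowU1 //; last first.
  have pi' : p <= i by apply: mi; apply/recordsP.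
  by move: lp pi pi'; do 2!case: ltnP => ? //=; lia.
by move: lp; do 2!case: ltnP => ? //=; lia.
Qed.

(** The path of T ends above its starting point, so the last time q at which
    it is at its minimum is not the end.  The step after q goes up; turning it
    down makes it a record, and the last one. *)
Lemma ex_up T : n < #|T|.*2 -> exists2 z, z \in T & last_record (T :\ z) z.
Proof.
move=> nT.
(* minimizing f picks the lowest point of the path, and the last one in case of
   ties: n - l < n.+1 is the tie-breaker *)
pose f l := ((below T l).*2 + (n - l)) * n.+1 + (n - l).
have [q qn mq] : exists2 q, q <= n & forall l, l <= n -> f q <= f l.
  case: (@arg_minnP _ (ord0 : 'I_n.+1) predT f isT) => q _ mq.
  exists q => [|l ln]; first by rewrite -ltnS.
  by have := mq (inord l) isT; rewrite inordK.
have h1 l : l <= n -> (below T q).*2 + l <= (below T l).*2 + q.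
  move=> ln; have := mq l ln; rewrite leqNgt => /negP h.
  rewrite leqNgt; apply/negP => hl; apply: h; rewrite /f.
  have : (below T l).*2 + (n - l) < (below T q).*2 + (n - q) by lia.
  have : n - l <= n by lia.
  move: ((below T l).*2 + (n - l)) ((below T q).*2 + (n - q)) (n - l) (n - q).
  move=> a b c d; nia.
have h2 l : q < l <= n -> (below T q).*2 + l < (below T l).*2 + q.
  move=> /andP[ql ln]; have := mq l ln; rewrite /f; have := h1 l ln.
  rewrite leq_eqVlt => /orP[/eqP e|//].
  have -> : (below T l).*2 + (n - l) = (below T q).*2 + (n - q) by lia.
  lia.
have {}qn : q < n.
  move: qn; rewrite leq_eqVlt => /orP[/eqP e|//].
  by have := h1 0 isT; rewrite e below_all below0; lia.
have [z zE] : exists z : 'I_n, z = q :> nat by exists (Ordinal qn).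
rewrite -{}zE in h1 h2.
have zT : z \in T.
  have := h2 z.+1; rewrite ltnSn ltn_ord => /(_ isT).
  by rewrite belowS; case: (z \in T) => //=; lia.
exists z => //; set U := T :\ z.
have zU : z \notin U by rewrite setD11.
have bT l : below T l = (z < l) + below U l.
  by rewrite -belowU1 // setD1K.
split.
  apply/recordsP => l lz; have := h1 l (leq_trans lz (ltnW (ltn_ord z))).
  by rewrite belowS (negbTE zU) !bT ltnn ltnNge lz /=; lia.
move=> p /recordsP hp; rewrite leqNgt; apply/negP => zp.
have := hp z.+1 zp; have := h2 p.+1; rewrite ltnS (ltnW zp) ltn_ord => /(_ isT).
by rewrite (belowS U z) (negbTE zU) !bT ltnn ltnS (ltnW zp) /=; lia.
Qed.

(** If z < z' then S contains z', and the up-step at z' brings the path of S to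
    the height of the path of S' after z', which is lower than the common height
    before z since z' is a record of S'.  So before that up-step the path of S
    is below the level reached at z, against [last_record_min]. *)
Lemma last_record_inj S S' z z' : last_record S z -> last_record S' z' ->
  z |: S = z' |: S' -> z = z'.
Proof.
wlog zz' : S S' z z' / z <= z'.
  move=> W h h' e; have [zz'|/ltnW zz'] := leqP z z'; first exact: W h h' e.
  by rewrite (W _ _ _ _ zz' h' h (esym e)).
move=> h h' e; apply/val_inj/eqP; rewrite eqn_leq zz' /= leqNgt; apply/negP => lt.
have b l : (z < l) + below S l = (z' < l) + below S' l.
  by rewrite -!belowU1 ?e //; exact: last_record_notin.
have z'S : z' \in S.
  have : z' \in z |: S by rewrite e setU11.
  by rewrite in_setU1 => /orP[/eqP E|//]; move: lt; rewrite E ltnn.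
have := last_record_min h (l := z'); rewrite lt ltnW // => /(_ isT).
have /recordsP/(_ z zz') := h'.1.
have := b z; have := b z'.+1; rewrite !belowS z'S (negbTE (last_record_notin h)).
rewrite (negbTE (last_record_notin h')) ltnn; lia.
Qed.

Definition run A D := [set p in D | [forall q in D, (p <= q) ==> (q \in A)]].

Lemma runP A D p : reflect (p \in D /\ {in D, forall q, p <= q -> q \in A})
  (p \in run A D).
Proof.
rewrite inE; apply: (iffP andP) => -[pD h]; split => //.
  by move=> q qD; have /forall_inP/(_ q qD)/implyP := h.
by apply/forall_inP => q qD; apply/implyP; exact: h.
Qed.

Lemma run_sub A D : run A D \subset D.
Proof. by apply/subsetP=> p /runP[]. Qed.

Lemma run_subA A D : run A D \subset A.
Proof. by apply/subsetP=> p /runP[pD]; apply. Qed.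

Lemma run0 A : run A set0 = set0.
Proof. by apply/eqP; rewrite -subset0 run_sub. Qed.

(** This is why the parity of the run changes when the last record is added
    to the set, if it lies in A. *)
Lemma card_run_last A D z : z \in D -> {in D, forall q, q <= z} ->
  #|run A D| = if z \in A then (#|run A (D :\ z)|).+1 else 0.
Proof.
move=> zD mz; case: ifP => zA; last first.
  apply/eqP; rewrite cards_eq0 -subset0; apply/subsetP=> p /runP[pD].
  by move=> /(_ z zD (mz p pD)); rewrite zA.
have -> : run A D = z |: run A (D :\ z).
  apply/setP=> p; rewrite in_setU1; apply/runP/orP => [[pD h]|].
    have [->|pz] := eqVneq p z; [by left|right].
    by apply/runP; split=> [|q /setD1P[_ qD]]; [rewrite in_setD1 pz | exact: h].
  case=> [/eqP ->|/runP[/setD1P[pz pD] h]]; split=> // q qD.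
    by move=> zq; have /anti_leq/val_inj <- : z <= q <= z by rewrite zq mz.
  by move=> pq; have [->//|qz] := eqVneq q z; apply: h; rewrite // in_setD1 qz.
rewrite cardsU1 (_ : z \notin _) //.
by apply: contraTN isT => /(subsetP (run_sub _ _)); rewrite setD11.
Qed.

Definition odd_run A S := odd #|run A (records S)|.

Lemma odd_run_up A S : odd_run A S ->
  exists2 z, last_record S z & z \in A /\ ~~ odd_run A (z |: S).
Proof.
rewrite /odd_run => o; have [z lz] : exists z, last_record S z.
  by apply: ex_last_record; apply: contraTneq o => ->; rewrite run0 cards0.
exists z => //; move: o; rewrite (recordsU1 (last_record_notin lz) lz.2).
by rewrite (card_run_last A lz.1 lz.2); case: ifP.
Qed.

Lemma odd_run_down A S z : last_record S z -> z \in A -> ~~ odd_run A (z |: S) ->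
  odd_run A S.
Proof.
move=> lz zA; rewrite /odd_run (recordsU1 (last_record_notin lz) lz.2).
by rewrite (card_run_last A lz.1 lz.2) zA.
Qed.

(** Suppose that the last record z' of S' is less than i.  Then adding i to S'
    does not change the records, hence not the run either, whereas adding z to
    S makes it one shorter.  So z |: S = i |: S' would be even by the first
    expression and odd by the second. *)
Lemma odd_run_exchange A S S' z z' i :
    last_record S z -> last_record S' z' -> odd_run A S -> odd_run A S' ->
    i \notin S' -> z |: S = i |: S' -> S != S' -> i < z'.
Proof.
move=> lz lz' oS oS' iS' e SS'; rewrite ltnNge; apply/negP => z'i.
have [ez|z'i'] := eqVneq z' i.
  have zz' : z = z' by apply: last_record_inj lz lz' _; rewrite ez.
  move/eqP: SS'; apply; rewrite -(setU1K (last_record_notin lz)) e.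
  by rewrite zz' ez setU1K.
have le : {in records S', forall q, q <= i}.
  by move=> q /lz'.2 qz'; exact: leq_trans z'i.
have iZ : records S' :\ i = records S'.
  apply/setP=> p; rewrite in_setD1; have [->|//] := eqVneq p i.
  apply/esym/negP => /lz'.2 iz'; move/eqP: z'i'; apply.
  by apply/val_inj/anti_leq; rewrite z'i.
have [x lx [_]] := odd_run_up oS.
by rewrite -(last_record_uniq lz lx) e /odd_run recordsU1 // iZ (negbF oS').
Qed.

End Records.

Local Open Scope ring_scope.

(** * The termination order *)

Section Weight.

Variable n : nat.
Implicit Types (S T A : {set 'I_n}) (i z : 'I_n).

Definition set_weight T : nat := (\sum_(i in T) (i : nat))%N.

Lemma set_weightU1 i S : i \notin S -> set_weight (i |: S) = (i + set_weight S)%N.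
Proof. exact: big_setU1. Qed.

Lemma set_weight_max T : (set_weight T <= \sum_i (i : 'I_n))%N.
Proof. by rewrite [leqRHS](bigID (fun i => i \in T)) leq_addr. Qed.

(** The sum of the elements of S with its last record added, in a form that
    needs no choice of that record. *)
Definition up_weight S : nat := (set_weight S + \max_(i in records S) i)%N.

Lemma up_weightE S z : last_record S z -> up_weight S = set_weight (z |: S).
Proof.
move=> lz; rewrite set_weightU1 ?last_record_notin // /up_weight addnC.
congr addn; apply/anti_leq/andP; split; first exact/bigmax_leqP/lz.2.
by apply: (bigmax_sup z); first exact: lz.1.
Qed.

Lemma up_weight_exchange A S S' i z : last_record S z ->
    odd_run A S -> odd_run A S' -> i \notin S' -> z |: S = i |: S' -> S != S' ->
  (up_weight S < up_weight S')%N.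
Proof.
move=> lz oS oS' iS' e SS'; have [z' lz' _] := odd_run_up oS'.
rewrite (up_weightE lz) (up_weightE lz') e !set_weightU1 ?(last_record_notin lz') //.
by rewrite ltn_add2r (odd_run_exchange lz lz' oS oS' iS' e SS').
Qed.

End Weight.

(** * Chains of the simplex on the variables *)

Section Chains.

Variables (K : comNzRingType) (n : nat).
Implicit Types (S T U A : {set 'I_n}) (i j : 'I_n).

(** The exterior algebra with scalars K, which is the Koszul complex in each
    squarefree degree once the monomials are removed. *)
Definition chain := {ffun {set 'I_n} -> K^o}.
Implicit Types (b c y : chain).

(** Also the sign of i in i |: U, since only the elements below i count. *)
Definition sg i U : K := (-1) ^+ below U i.

Lemma sg_sq i U : sg i U * sg i U = 1.
Proof. by rewrite -expr2 sqrr_sign. Qed.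

Lemma sg_swap i j U : i != j -> i \notin U -> j \notin U ->
  sg j (i |: U) * sg i U = - (sg i (j |: U) * sg j U).
Proof.
move=> ij iU jU; rewrite /sg !belowU1 // !exprD.
have /negPf ij' : (i : nat) != j by [].
case: (ltngtP i j) ij' => //= ij' _; rewrite expr0 expr1 ?mul1r mulN1r mulNr;
by rewrite ?opprK mulrC.
Qed.

Definition bd c : chain :=
  [ffun U : {set 'I_n} => \sum_(i | i \notin U) sg i U * c (i |: U)].

Fact bd_linear : linear bd.
Proof.
move=> a b c; apply/ffunP=> U; rewrite !ffunE scaler_sumr -big_split /=.
apply: eq_bigr => i _; rewrite !ffunE mulrDr; congr (_ + _).
by rewrite /GRing.scale /= mulrCA.
Qed.
HB.instance Definition _ := GRing.isLinear.Build K chain chain _ bd bd_linear.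

(** The terms for (i, j) and (j, i) cancel; they are paired as i < j and j < i,
    since in characteristic 2 antisymmetry alone would not suffice. *)
Lemma bd_bd c : bd (bd c) = 0.
Proof.
apply/ffunP=> U; rewrite !ffunE.
pose f i j := sg i U * (sg j (i |: U) * c (j |: (i |: U))).
transitivity (\sum_(i | i \notin U) \sum_(j | (j \notin U) && (j != i)) f i j).
  apply: eq_bigr => i iU; rewrite ffunE mulr_sumr; apply: eq_bigl => j.
  by rewrite in_setU1 negb_or andbC.
have -> : \sum_(i | i \notin U) \sum_(j | (j \notin U) && (j != i)) f i j =
    \sum_(i | i \notin U) \sum_(j | (j \notin U) && (j < i)%N) f i j +
    \sum_(i | i \notin U) \sum_(j | (j \notin U) && (i < j)%N) f i j.
  rewrite -big_split; apply: eq_bigr => i _.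
  rewrite (bigID (fun j : 'I_n => (j < i)%N)) /=; congr (_ + _).
    by apply: eq_bigl => j; rewrite -andbA -(inj_eq val_inj) /=; case: ltngtP.
  apply: eq_bigl => j; rewrite -andbA -(inj_eq val_inj) /=.
  by case: ltngtP.
rewrite [X in _ + X](exchange_big_dep (fun j => j \notin U)) //=.
  rewrite -big_split big1 // => i iU /=.
  rewrite [X in _ + X](eq_bigl (fun j => (j \notin U) && (j < i)%N)); last first.
    by move=> j; rewrite iU.
  rewrite -big_split big1 // => j.
  move=> /andP[jU ji]; rewrite /f /= setUCA mulrA [X in _ + X]mulrA -mulrDl.
  rewrite [sg i U * _]mulrC sg_swap ?(mulrC (sg j U)) ?addNr ?mul0r //.
  by apply: contraTneq ji => ->; rewrite ltnn.
by move=> i j _ /andP[].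
Qed.

Definition face S : chain := [ffun T : {set 'I_n} => (T == S)%:R].

Lemma bd_face T : bd (face T) = \sum_(i in T) sg i T *: face (T :\ i).
Proof.
apply/ffunP=> U; rewrite ffunE sum_ffunE [LHS]big_mkcond [RHS]big_mkcond /=.
apply: eq_bigr => i _; rewrite !ffunE.
have [<-|iUT] := eqVneq (i |: U) T.
  rewrite setU11; have [iU|iU] := boolP (i \in U) => /=.
    have [e|_] := eqVneq U ((i |: U) :\ i); last by rewrite scaler0.
    by move: iU; rewrite e setD11.
  by rewrite setU1K // eqxx /sg belowU1 // ltnn.
rewrite mulr0 if_same; case: ifP => // iT.
have [UT|_] := eqVneq U (T :\ i); last by rewrite scaler0.
by move: iUT; rewrite UT setD1K ?eqxx.
Qed.

Definition even_chain A (k : nat) b :=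
  forall S, b S != 0 -> [/\ S \subset A, #|S| = k & ~~ odd_run A S].

Lemma even_chain_sum A k (I : Type) (r : seq I) (P : pred I) (a : I -> K)
    (b : I -> chain) : (forall x, P x -> even_chain A k (b x)) ->
  even_chain A k (\sum_(x <- r | P x) a x *: b x).
Proof.
move=> hb; apply: big_ind => [S|x y hx hy S|i Pi S].
- by rewrite ffunE eqxx.
- rewrite ffunE; have [->|/hx //] := eqVneq (x S) 0; rewrite add0r; exact: hy.
- rewrite ffunE; have [->|/(hb _ Pi) //] := eqVneq (b i S) 0.
  by rewrite scaler0 eqxx.
Qed.

(** By induction on up_weight, from the top: for S odd and T = up S, the
    relation bd (bd (face T)) = 0 expresses bd (face S) through the boundaries
    of the other facets of T, each of which is even or of larger weight. *)
Lemma face_span A k S : S \subset A -> #|S| = k ->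
  exists2 b, even_chain A k b & bd b = bd (face S).
Proof.
pose B := (\sum_i (i : 'I_n)).+1.
have [m] := ubnP (B - up_weight S); elim: m S => // m IH S le SA Sk.
have [oS|eS] := boolP (odd_run A S); last first.
  exists (face S) => // T; rewrite ffunE.
  by have [-> _|_ /eqP //] := eqVneq T S.
have [z lz [zA _]] := odd_run_up oS.
pose T := z |: S; have zS := last_record_notin lz.
have TA : T \subset A by rewrite subUset sub1set zA.
have Tk i : i \in T -> #|T :\ i| = k.
  by move=> iT; have := cardsD1 i T; rewrite iT cardsU1 zS Sk => -[].
have hb i : exists b, (i \in T) && (i != z) ->
    even_chain A k b /\ bd b = bd (face (T :\ i)).
  case: (boolP (_ && _)) => [/andP[iT iz]|_]; last by exists 0.
  suff [b ? ?] : exists2 b, even_chain A k b & bd b = bd (face (T :\ i)).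
    by exists b.
  have TiA : T :\ i \subset A by apply: subset_trans TA; exact: subsetDl.
  have [oTi|eTi] := boolP (odd_run A (T :\ i)); last first.
    exists (face (T :\ i)) => // U; rewrite ffunE.
    by have [-> _|_ /eqP //] := eqVneq U (T :\ i); split=> //; exact: Tk.
  apply: IH => //; last exact: Tk.
  have [z' lz' _] := odd_run_up oTi.
  have lt : (up_weight S < up_weight (T :\ i))%N.
    apply: (up_weight_exchange (i := i) lz oS oTi); rewrite ?setD11 //.
      by rewrite setD1K.
    apply: contraNneq zS => ->; by rewrite in_setD1 eq_sym iz setU11.
  have := set_weight_max (z' |: (T :\ i)); rewrite -(up_weightE lz').
  move: le lt; rewrite /B; lia.
have {hb} [b hb] := boolp.choice hb.
exists (\sum_(i in T | i != z) (- (sg z T * sg i T)) *: b i).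
  by apply: even_chain_sum => i /hb[].
rewrite linear_sum /=.
have /(congr1 (fun c => sg z T *: c)) := bd_bd (face T).
rewrite scaler0 bd_face linear_sum (bigD1 z) ?setU11 //= linearZ /= scalerDr.
rewrite scalerA sg_sq scale1r setU1K // => /eqP; rewrite addr_eq0 => /eqP ->.
rewrite scaler_sumr -sumrN; apply: eq_bigr => i iP.
by rewrite !linearZ /= (hb i iP).2 scalerA scalerN scaleNr.
Qed.

Lemma chainE c : c = \sum_S (c S : K) *: face S.
Proof.
apply/ffunP=> T; rewrite sum_ffunE (bigD1 T) //= big1 ?addr0.
  by rewrite !ffunE eqxx /GRing.scale /= mulr1.
move=> S ST; rewrite !ffunE eq_sym (negbTE ST) scaler0 //.
Qed.

Lemma chain_span A k c : (forall S, c S != 0 -> S \subset A /\ #|S| = k) ->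
  exists2 b, even_chain A k b & bd b = bd c.
Proof.
move=> hc.
have hb S : exists b, c S != 0 -> even_chain A k b /\ bd b = bd (face S).
  have [//|cS] := eqVneq (c S) 0; first by exists 0.
  by have [SA Sk] := hc S cS; have [b ? ?] := face_span SA Sk; exists b.
have {hb} [b hb] := boolp.choice hb.
exists (\sum_(S | c S != 0) (c S : K) *: b S).
  by apply: even_chain_sum => S /hb[].
rewrite [in RHS](chainE c) !linear_sum [RHS](bigID (fun S => c S != 0)) /=.
rewrite [X in _ + X]big1 ?addr0 => [|S /negPn/eqP ->]; last first.
  by rewrite scale0r linear0.
by apply: eq_bigr => S cS; rewrite !linearZ /= (hb S cS).2.
Qed.

(** The contracting homotopy of the simplex with apex i. *)
Definition cone i c : chain :=
  [ffun T : {set 'I_n} => if i \in T then sg i T * c (T :\ i) else 0].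

Lemma bd_cone i c : bd c = 0 -> bd (cone i c) = c.
Proof.
move=> c0; apply/ffunP=> U; rewrite ffunE; have [iU|iU] := boolP (i \in U).
  have [V iV ->] : exists2 V : {set 'I_n}, i \notin V & U = i |: V.
    by exists (U :\ i); rewrite ?setD11 // setD1K.
  have /ffunP/(_ V) := c0; rewrite !ffunE (bigD1 i) //=.
  move=> /(congr1 ( *%R (sg i V))); rewrite mulr0 mulrDr mulrA sg_sq mul1r.
  move=> /eqP; rewrite addr_eq0 mulr_sumr -sumrN => /eqP ->.
  apply: eq_big => [j|j]; rewrite in_setU1 negb_or; first by rewrite andbC.
  move=> /andP[ji jV]; rewrite setUCA ffunE setU11 setU1K; last first.
    by rewrite in_setU1 negb_or eq_sym ji.
  have -> : sg i (i |: (j |: V)) = sg i (j |: V).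
    by rewrite /sg belowU1 ?ltnn // in_setU1 negb_or eq_sym ji.
  (* multiply the anticommutation of the signs of i and j by sg i V *)
  rewrite -[sg j _]mulr1 -(sg_sq i V) [sg j _ * (_ * _)]mulrA sg_swap ?(eq_sym i) //.
  rewrite !mulNr -[sg i V * _ in RHS]mul1r -(sg_sq i (j |: V)).
  by congr (- _); ring.
rewrite (bigD1 i) //= [X in _ + X]big1 ?addr0.
  rewrite ffunE setU11 setU1K // mulrA.
  have -> : sg i (i |: U) = sg i U by rewrite /sg belowU1 // ltnn.
  by rewrite sg_sq mul1r.
move=> j /andP[jU ji]; rewrite ffunE in_setU1 eq_sym (negbTE ji) (negbTE iU).
by rewrite mulr0.
Qed.

(** By [bd_cone] and [chain_span], c is the boundary of a chain b supported on
    even faces with one more vertex.  If b were nonzero, let T be of least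
    weight in its support.  The bound on n makes T of the form up S, with S odd.
    Any other set i |: S in the support of b would have smaller weight by
    [odd_run_exchange]; so there is none, and c is nonzero at the odd set S. *)
Lemma even_chain_cycle A k c : (0 < k)%N -> (n < k.+1.*2)%N ->
  even_chain A k c -> bd c = 0 -> c = 0.
Proof.
move=> k0 nk ec c0; apply/eqP/negPn/negP => cN.
have [S0 cS0] : exists S, c S != 0.
  apply/existsP; apply: contraNT cN => /existsPn h.
  by apply/eqP/ffunP=> S; rewrite ffunE; apply/eqP; have := h S; rewrite negbK.
have [S0A S0k _] := ec _ cS0.
have [a aS0] : exists a, a \in S0 by apply/set0Pn; rewrite -card_gt0 S0k.
have [b eb bdb] : exists2 b, even_chain A k.+1 b & bd b = bd (cone a c).
  apply: chain_span => T; rewrite ffunE; case: ifP => [aT|_]; last by rewrite eqxx.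
  have [->|/ec [TA Tk _] _] := eqVneq (c (T :\ a)) 0; first by rewrite mulr0 eqxx.
  split; last by rewrite (cardsD1 a) aT Tk.
  by rewrite -(setD1K aT) subUset sub1set TA (subsetP S0A).
rewrite bd_cone // in bdb.
have [T0 bT0] : exists T, b T != 0.
  apply/existsP; apply: contraNT cN => /existsPn h; rewrite -bdb.
  suff -> : b = 0 by rewrite linear0.
  by apply/ffunP=> S; rewrite ffunE; apply/eqP; have := h S; rewrite negbK.
have up T : b T != 0 -> exists2 z, z \in T &
    last_record (T :\ z) z /\ odd_run A (T :\ z).
  move=> /eb[TA Tk eT]; have [|z zT lz] := @ex_up _ T; first by rewrite Tk.
  exists z => //; split=> //; apply: (odd_run_down lz); first exact: (subsetP TA).
  by rewrite setD1K.
case: (@arg_minnP _ T0 (fun T => b T != 0) (@set_weight n) bT0) => T bT minT.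
have [z zT [lz oS]] := up T bT; set S := T :\ z in lz oS.
have zS : z \notin S by rewrite setD11.
have : c S != 0.
  rewrite -bdb ffunE (bigD1 z) //= [X in _ + X]big1 ?addr0.
    rewrite setD1K //; apply: contraNneq bT => /(congr1 ( *%R (sg z S))).
    by rewrite mulrA sg_sq mul1r mulr0 => ->.
  move=> i /andP[iS iz]; have [->|bT'] := eqVneq (b (i |: S)) 0.
    by rewrite mulr0.
  have [z' z'T' [lz' oS']] := up _ bT'.
  have := minT _ bT'; rewrite -[T in X in (X <= _)%N](setD1K zT) -/S.
  rewrite !set_weightU1 // leq_add2r leqNgt => /negP[].
  apply: (odd_run_exchange lz' lz oS' oS iS); first by rewrite setD1K.
  apply: contraNneq iz => e; rewrite (last_record_uniq lz (z' := z')).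
    move: z'T'; rewrite in_setU1 => /orP[/eqP -> //|].
    by rewrite -e setD11.
  by rewrite -e.
by move=> /ec[_ _]; rewrite oS.
Qed.

End Chains.

(** * Homogeneous parts of the Koszul complex *)

Section Monomials.

Variables (R : nzRingType) (n : nat).
Implicit Types (S A : {set 'I_n}) (a w : 'X_{1..n}) (p : {mpoly R[n]}).

Definition mset S : 'X_{1..n} := [multinom (i \in S : nat) | i < n].
Definition msupport a : {set 'I_n} := [set i | a i != 0%N].

Lemma mset_le S a : (mset S <= a)%MM = (S \subset msupport a).
Proof.
apply/mnm_lepP/subsetP=> h i; last first.
  rewrite mnmE; case: (boolP (i \in S)) => // /h.
  by rewrite inE lt0n.
by move=> iS; have := h i; rewrite mnmE iS inE lt0n.
Qed.

Lemma msetU1 i S : i \notin S -> mset (i |: S) = (U_(i) + mset S)%MM.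
Proof.
move=> iS; apply/mnmP=> j; rewrite !mnmE in_setU1 eq_sym.
by have [<-|] := eqVneq i j; rewrite ?(negbTE iS).
Qed.

Lemma mcoeffMXE p (m : 'X_{1..n}) w :
  (p * 'X_[m])@_w = if (m <= w)%MM then p@_(w - m) else 0.
Proof.
case: ifP => [mw|]; first by rewrite -{1}(submK mw) addmC mcoeffMX.
apply: contraFeq; rewrite -mcoeff_msupp (perm_mem (msuppMX _ _)).
by move=> /mapP[u _ ->]; exact: lem_addr.
Qed.

End Monomials.

Section Transfer.

Variables (K : fieldType) (n : nat).
Implicit Types (S U A : {set 'I_n}) (a : 'X_{1..n}) (c : chain K n).

(** Grouped by target: the only faces with a component at U are the i |: U. *)
Lemma koszul_diffE (v : exterior K n) U : koszul_diff v U =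
  \sum_(i | i \notin U) (sg K i U)%:MP * ((v (i |: U) : {mpoly K[n]}) * 'X_i).
Proof.
rewrite /koszul_diff sum_ffunE.
under eq_bigr => S _ do
  rewrite !ffunE /koszul_basis_diff sum_ffunE scaler_sumr big_mkcond.
rewrite exchange_big [RHS]big_mkcond /=; apply: eq_bigr => i _.
case: ifP => iU; last first.
  rewrite big1 // => S _; case: ifP => // iS; rewrite !ffunE.
  have [e|_] := eqVneq U (S :\ i); last by rewrite !scaler0.
  by move: iU; rewrite e setD11.
rewrite (bigD1 (i |: U)) //= big1 ?addr0 => [|S SU]; last first.
  case: ifP => // iS; rewrite !ffunE.
  have [e|_] := eqVneq U (S :\ i); last by rewrite !scaler0.
  by move: SU; rewrite e setD1K ?eqxx.
rewrite setU11 !ffunE setU1K // eqxx /GRing.scale /= mulr1.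
rewrite -[#|_|]/(below (i |: U) i) belowU1 // ltnn /sg.
by rewrite rmorphXn rmorphN1 mulrCA.
Qed.

(** The element of degree a with coefficients c.  It is meaningful when c is
    supported on subsets of the support of a, as the subtraction of exponents
    is truncated. *)
Definition homogenize a c : exterior K n :=
  [ffun S => ((c S : K)%:MP * 'X_[a - mset S] : {mpoly K[n]})].

Lemma koszul_diff_homogenize a c : (forall S, c S != 0 -> S \subset msupport a) ->
  koszul_diff (homogenize a c) = homogenize a (bd c).
Proof.
move=> ha; apply/ffunP=> U; rewrite koszul_diffE !ffunE rmorph_sum mulr_suml.
apply: eq_bigr => i iU; rewrite !ffunE /= rmorphM /= -!mulrA; congr (_ * _).
have [->|/ha] := eqVneq (c (i |: U)) 0; first by rewrite rmorph0 !mul0r.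
rewrite -mset_le => le; congr (_ * _); rewrite -mpolyXD; congr 'X_[_].
move: le => /mnm_lepP le; apply/mnmP=> j; have := le j.
by rewrite msetU1 // !mnmE; lia.
Qed.

Lemma homogenize_face u S :
  homogenize (u + mset S) (face K S) = 'X_[u] *: ext_basis K S.
Proof.
apply/ffunP=> T; rewrite !ffunE /GRing.scale /=.
by have [->|_] := eqVneq T S; rewrite ?addmK ?mpolyC1 ?mul1r ?mulr1 ?mpolyC0 ?mul0r ?mulr0.
Qed.

(** The component of degree a, with the monomials removed. *)
Definition degree_part a (v : exterior K n) : chain K n :=
  [ffun S : {set 'I_n} => if S \subset msupport a
     then (v S : {mpoly K[n]})@_(a - mset S) else 0].

Lemma degree_part_diff a v : degree_part a (koszul_diff v) = bd (degree_part a v).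
Proof.
apply/ffunP=> U; rewrite !ffunE koszul_diffE; case: ifPn => UA; last first.
  rewrite big1 // => i iU; rewrite ffunE ifN ?mulr0 //.
  by apply: contra UA; apply: subset_trans; exact: subsetUr.
rewrite raddf_sum; apply: eq_bigr => i iU; rewrite ffunE /= mcoeffCM mcoeffMXE.
rewrite subUset sub1set UA andbT lep1mP mnmE mnmE (negbTE iU) subn0 inE.
case: ifP => // _; rewrite msetU1 // submDA; congr (_ * _@_ _).
by rewrite addmC.
Qed.

End Transfer.

(** * Splitting the supports into cones *)

Section Intervals.

Variable n : nat.
Implicit Types (A D R : {set 'I_n}) (p q : 'I_n).

(** D consists of the last elements of R. *)
Definition top_part R D : bool :=
  (D \subset R) && [forall p in D, forall q in R, (p <= q)%N ==> (q \in D)].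

Lemma top_partP R D : reflect
  (D \subset R /\ {in D & R, forall p q : 'I_n, (p <= q)%N -> q \in D}) (top_part R D).
Proof.
apply: (iffP andP) => -[DR h]; split=> //.
  by move=> p q pD qR; have /forall_inP/(_ p pD)/forall_inP/(_ q qR)/implyP := h.
by apply/forall_inP => p pD; apply/forall_inP => q qR; apply/implyP; exact: h.
Qed.

(** The singleton of the largest element of R :\: D, or the empty set if D
    exhausts R; a set rather than an option, so that its complement is the set
    of variables of a piece in both cases. *)
Definition next_record R D : {set 'I_n} :=
  [set q in R :\: D | [forall p in R :\: D, (p <= q)%N]].

Lemma next_recordP R D q : reflect
  (q \in R :\: D /\ {in R :\: D, forall p : 'I_n, (p <= q)%N}) (q \in next_record R D).
Proof.
rewrite [_ \in next_record _ _]in_set; apply: (iffP andP) => -[qD h]; split=> //.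
  by move=> p pD; have /forall_inP/(_ p pD) := h.
by apply/forall_inP => p pD; exact: h.
Qed.

Lemma card_next_record R D : (#|next_record R D| <= 1)%N.
Proof.
apply/card_le1_eqP => p q /next_recordP[pD mp] /next_recordP[qD mq].
by apply/val_inj/anti_leq; rewrite mq // mp.
Qed.

Lemma top_part_run A R : top_part R (run A R).
Proof.
apply/top_partP; split=> [|p q /runP[_ h] qR pq]; first exact: run_sub.
by apply/runP; split=> // r rR qr; apply: h => //; exact: leq_trans qr.
Qed.

Lemma next_record_run A R q : q \in next_record R (run A R) -> q \notin A.
Proof.
move=> /next_recordP[/setDP[qR qr] mq]; apply: contraNN qr => qA.
apply/runP; split=> // p pR qp; have [pr|pr] := boolP (p \in run A R).
  exact: (subsetP (run_subA A R)).
suff -> : p = q by [].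
by apply/val_inj/anti_leq; rewrite qp andbT mq // inE pr.
Qed.

(** With the two lemmas before it, this identifies the sets A for which the run
    is D: they contain D and avoid the next element of R. *)
Lemma top_part_eq_run A R D : top_part R D -> D \subset A ->
  {in next_record R D, forall q, q \notin A} -> D = run A R.
Proof.
move=> /top_partP[DR closD] DA nA; apply/setP=> p; apply/idP/runP.
  move=> pD; split=> [|q qR pq]; first exact: (subsetP DR).
  by apply: (subsetP DA); exact: closD pq.
move=> [pR hp]; apply: contraPT isT => pD _.
have pRD : p \in R :\: D by rewrite inE pD.
case: (@arg_maxnP _ p (fun q => q \in R :\: D) (fun q : 'I_n => q : nat) pRD).
move=> q qRD mq; have /nA/negP : q \in next_record R D by apply/next_recordP.
by case; apply: hp; [case/setDP: qRD | exact: mq].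
Qed.

End Intervals.

(** * Stanley families *)

Section Families.

Variables (K : fieldType) (n : nat) (M : gradedModule K n).

(** Linear form of the definition: the generators span, and a vanishing
    combination with coefficients in the K[Z i] is trivial.  The latter also
    contains the freeness of each summand. *)
Lemma stanley_decomposition_fin (I : finType) (Z : I -> {set 'I_n}) (m : I -> M) :
    (forall i, exists a, ghom a (m i)) ->
    (forall x, exists2 p, forall i, poly_in (Z i) (p i) & x = \sum_i p i *: m i) ->
    (forall p, (forall i, poly_in (Z i) (p i)) -> \sum_i p i *: m i = 0 ->
       forall i, p i = 0) ->
  stanley_decomposition (StanleyFamily (fun j : 'I_#|I| => Z (enum_val j))
                                       (fun j => m (enum_val j))).
Proof.
move=> hom span free; pose idx (j : 'I_#|I|) : I := enum_val j.
have sumE (F : I -> M) : \sum_i F i = \sum_j F (idx j).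
  by rewrite (reindex (@enum_val _ predT)) //=; exact/onW_bij/enum_val_bij.
have poly_in0 Y : poly_in Y (0 : {mpoly K[n]}) by move=> u; rewrite msupp0.
split=> [j|x] /=.
  split=> [|p pZ p0]; first exact: hom.
  pose P i := if i == enum_val j then p else 0.
  suff /(_ (enum_val j)) : forall i, P i = 0 by rewrite /P eqxx.
  apply: free => [i|]; first by rewrite /P; case: eqP => [->|].
  rewrite (bigD1 (enum_val j)) //= {1}/P eqxx p0 add0r big1 // => i /negbTE ij.
  by rewrite /P ij scale0r.
have [p pZ xE] := span x.
exists [ffun j => p (idx j) *: m (idx j)]; split.
  split=> [j|]; first by rewrite ffunE; exists (p (idx j)).
  by rewrite xE sumE; apply: eq_bigr => j _; rewrite ffunE.
move=> y [hy yE]; have /boolp.choice[q hq] : forall j, exists q,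
    poly_in (Z (idx j)) q /\ y j = q *: m (idx j).
  by move=> j; have [q ? ?] := hy j; exists q.
have pq : forall i, p i - q (enum_rank i) = 0.
  apply: free => [i u|].
    move=> /msuppB_le; rewrite mem_cat => /orP[]; first exact: pZ.
    by have := (hq (enum_rank i)).1 u; rewrite /idx enum_rankK.
  under eq_bigr => i _ do rewrite scalerBl.
  rewrite sumrB -xE yE sumE -sumrB big1 // => j _.
  by rewrite (hq j).2 /idx enum_valK subrr.
apply/ffunP=> j; rewrite ffunE (hq j).2; congr (_ *: _).
by have /eqP := pq (idx j); rewrite subr_eq0 /idx enum_valK => /eqP.
Qed.

Lemma bigminn_le (I : finType) (F : I -> nat) d i :
  (\big[minn/d]_i F i <= F i)%N.
Proof.
have : i \in index_enum I by rewrite mem_index_enum.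
elim: (index_enum I) => // j r IH; rewrite inE big_cons => /orP[/eqP <-|/IH h].
  exact: geq_minl.
exact: leq_trans (geq_minr _ _) h.
Qed.

Lemma stanley_family_depth_ge (D : stanley_family M) d : (d <= n)%N ->
  (forall i, (d <= #|sf_set (s := D) i|)%N) -> (d <= stanley_family_depth D)%N.
Proof.
move=> dn h; rewrite /stanley_family_depth; elim/big_ind: _ => // x y dx dy.
by rewrite leq_min dx.
Qed.

End Families.

(** * The Stanley decomposition of a Koszul syzygy module *)

Section Syzygies.

Variables (K : fieldType) (n k : nat).
Implicit Types (S D T U A : {set 'I_n}).
Local Notation M := (koszul_syz_module K n k).
Local Notation mpoly := {mpoly K[n]}.

Lemma val_koszul_gen S : #|S| = k ->
  val (koszul_gen K k S) = koszul_diff (ext_basis K S).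
Proof. by move=> /= ->; rewrite eqxx. Qed.

Lemma val_scale_gen (p : mpoly) S : #|S| = k ->
  val (p *: koszul_gen K k S) = p *: koszul_diff (ext_basis K S).
Proof. by move=> Sk; rewrite -val_koszul_gen // linearZ. Qed.

Lemma val_koszul_gen_face S i : #|S| = k -> i \in S ->
  val (koszul_gen K k S) (S :\ i) = (sg K i (S :\ i))%:MP * 'X_i :> mpoly.
Proof.
move=> Sk iS; rewrite val_koszul_gen // koszul_diffE (bigD1 i) ?setD11 //=.
rewrite setD1K // ffunE eqxx mul1r big1 ?addr0 // => j /andP[_ ji].
rewrite ffunE; have [e|_] := eqVneq (j |: S :\ i) S; last by rewrite mul0r mulr0.
have : i \in j |: S :\ i by rewrite e.
by rewrite in_setU1 setD11 orbF eq_sym (negbTE ji).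
Qed.

(** This is the vanishing of the double boundary of e_T, read off from
    [bd_bd] in degree mset T. *)
Lemma koszul_boundary_relation T : #|T| = k.+1 ->
  \sum_(i in T) ((sg K i T)%:MP * 'X_i) *: koszul_gen K k (T :\ i) = 0.
Proof.
move=> Tk; apply: val_inj; rewrite raddf_sum raddf0.
have -> : \sum_(i in T) val (((sg K i T)%:MP * 'X_i) *: koszul_gen K k (T :\ i)) =
    koszul_diff (koszul_diff (ext_basis K T)).
  rewrite koszul_diff_basis /koszul_basis_diff linear_sum; apply: eq_bigr => i iT.
  have Ti : #|T :\ i| = k by have := cardsD1 i T; rewrite iT Tk => -[].
  rewrite linearZ [RHS]linearZ /= Ti eqxx; congr (_ *: _); congr (_ * _).
  by rewrite /sg rmorphXn rmorphN1.
rewrite -[ext_basis K T]scale1r -mpolyX0 -homogenize_face add0m.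
rewrite koszul_diff_homogenize => [|S]; last first.
  rewrite ffunE; have [-> _|_ /eqP //] := eqVneq S T.
  by rewrite -mset_le lepm_refl.
rewrite koszul_diff_homogenize => [|S].
  by rewrite bd_bd; apply/ffunP=> S; rewrite !ffunE mpolyC0 mul0r.
rewrite bd_face sum_ffunE => /eqP h.
have [i iT] : exists2 i, i \in T & S = T :\ i.
  have [/exists_inP[i iT /eqP ->]|/exists_inPn nS] := boolP [exists i in T, S == T :\ i].
    by exists i.
  case: h; rewrite big1 // => i iT; rewrite !ffunE (negbTE (nS i iT)) //.
  by rewrite scaler0.
move=> ->; rewrite (subset_trans (subsetDl _ _)) //.
by rewrite -mset_le lepm_refl.
Qed.

(** The pair (S, D) stands for the cone of X^D g_S, where g_S is selected in
    the degrees whose support has run D. *)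
Definition piece : pred ({set 'I_n} * {set 'I_n}) :=
  fun x => [&& #|x.1| == k, top_part (records x.1) x.2 & ~~ odd #|x.2|].

Definition pieces := {x | piece x}.
Implicit Types (x : pieces).

Definition piece_vars x : {set 'I_n} := ~: next_record (records (val x).1) (val x).2.

Definition piece_gen x : M := 'X_[mset (val x).2] *: koszul_gen K k (val x).1.

Lemma piece_gen_hom x : exists a, ghom a (piece_gen x).
Proof.
have [a ha] := ext_homXm (mset (val x).2) (@koszul_gen_hom K n k (val x).1).
by exists a; rewrite /ghom /= /koszul_syz_hom /piece_gen linearZ.
Qed.

Lemma card_piece_vars x : (n - 1 <= #|piece_vars x|)%N.
Proof. by rewrite cardsCs setCK card_ord leq_sub2l // card_next_record. Qed.

(** A summand K[Z]X^D g_S contributes to degree a at S only if D is the run of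
    S in the support of a; hence at most one summand does for each S. *)
Lemma piece_run x (p : mpoly) a : poly_in (piece_vars x) p ->
  (p * 'X_[mset (val x).2])@_(a - mset (val x).1) != 0 ->
  (val x).2 = run (msupport a) (records (val x).1).
Proof.
case: x => -[S D] xP pZ /=; have /and3P[_ topD _] := xP; rewrite mcoeffMXE.
case: ifP => [le pa|_]; last by rewrite eqxx.
have [DR _] := top_partP _ _ topD.
apply: top_part_eq_run => // [|q qn].
  apply/subsetP => q qD; have := mnm_lepP le q; rewrite !mnmE qD inE.
  by case: (a q).
have /next_recordP[/setDP[qR qD] _] := qn.
rewrite -mcoeff_msupp in pa; have := pZ _ pa q.
rewrite /piece_vars /= in_setC qn => /(_ isT); rewrite !mnmE (negbTE qD).
by rewrite (negbTE (records_notin qR)) !subn0 inE => ->.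
Qed.

Definition spanned (y : M) := exists2 p : pieces -> mpoly,
  forall x, poly_in (piece_vars x) (p x) & y = \sum_x p x *: piece_gen x.

Lemma spannedD y z : spanned y -> spanned z -> spanned (y + z).
Proof.
move=> [p pZ ->] [q qZ ->]; exists (fun x => p x + q x) => [x u|].
  by move=> /msuppD_le; rewrite mem_cat => /orP[/pZ|/qZ].
by rewrite -big_split; apply: eq_bigr => x _; rewrite scalerDl.
Qed.

Lemma spanned_piece x p : poly_in (piece_vars x) p -> spanned (p *: piece_gen x).
Proof.
move=> px; exists (fun z => if z == x then p else 0) => [z|].
  by case: eqP => [->//|_] u; rewrite msupp0.
rewrite (bigD1 x) //= eqxx big1 ?addr0 // => z /negbTE ->.
by rewrite scale0r.
Qed.

Lemma spanned0 : spanned 0.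
Proof.
exists (fun=> 0) => [x u|]; first by rewrite msupp0.
by rewrite big1 // => x _; rewrite scale0r.
Qed.

Lemma spanned_sum (I : Type) (r : seq I) (P : pred I) (F : I -> M) :
  (forall i, P i -> spanned (F i)) -> spanned (\sum_(i <- r | P i) F i).
Proof.
by move=> h; apply: big_ind => //; [exact: spanned0 | exact: spannedD].
Qed.

(** Applying [face_span] in the support A of the degree a of X^u g_S replaces
    it by multiples of even g_T, and each of these lies in the cone of
    (T, run of T in A). *)
Lemma spanned_monomial (c : K) u S : #|S| = k ->
  spanned ((c%:MP * 'X_[u]) *: koszul_gen K k S).
Proof.
move=> Sk; have [a aE] : exists a, a = (u + mset S)%MM by exists (u + mset S)%MM.
set A := msupport a; have SA : S \subset A by rewrite -mset_le aE lem_addl.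
have [b eb bdb] := face_span K SA Sk.
have -> : (c%:MP * 'X_[u]) *: koszul_gen K k S =
   \sum_(T | b T != 0) ((c * b T)%:MP * 'X_[a - mset T]) *: koszul_gen K k T.
  have kdX (q : mpoly) w : koszul_diff (q *: w) = q *: koszul_diff w.
    exact: linearZ.
  apply: val_inj; rewrite val_scale_gen // -scalerA -kdX -homogenize_face -aE.
  rewrite koszul_diff_homogenize => [|T]; last first.
    by rewrite ffunE; have [-> //|_ /eqP //] := eqVneq T S.
  rewrite -bdb -koszul_diff_homogenize => [|T /eb[] //].
  rewrite -kdX raddf_sum /koszul_diff [RHS]big_mkcond /=.
  apply: eq_bigr => T _; have [b0|/eb[_ Tk _]] := eqVneq (b T) 0.
    by rewrite !ffunE b0 mpolyC0 mul0r scaler0 scale0r.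
  rewrite [RHS](val_scale_gen _ Tk) koszul_diff_basis; congr (_ *: _).
  by rewrite !ffunE /GRing.scale /= mpolyCM mulrA.
apply: spanned_sum => T bT; have [TA Tk eT] := eb _ bT.
have px : piece (T, run A (records T)).
  by rewrite /piece /= Tk eqxx top_part_run.
pose x : pieces := Sub (T, run A (records T)) px; set D := run A (records T).
have Da : (mset D <= a - mset T)%MM.
  apply/mnm_lepP => i; rewrite !mnmE; have [iD|//] := boolP (i \in D).
  have := subsetP (run_subA _ _) _ iD; rewrite inE.
  have /records_notin/negbTE -> := subsetP (run_sub _ _) _ iD.
  by rewrite subn0 lt0n.
rewrite -(submK Da) mpolyXD mulrA -scalerA -[_ *: koszul_gen _ _ _]/(piece_gen x).
apply: spanned_piece => w; rewrite mul_mpolyC => /msuppZ_le.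
rewrite msuppX inE => /eqP -> i; rewrite in_setC negbK => /next_record_run.
by rewrite inE negbK => /eqP ai; rewrite !mnmE ai !sub0n.
Qed.

Lemma spanned_all y : spanned y.
Proof.
have [c ->] := koszul_genP y; apply: spanned_sum => S _.
have [Sk|Sk] := eqVneq #|S| k; last first.
  have -> : koszul_gen K k S = 0.
    by apply: val_inj; rewrite /= (negbTE Sk) linear0.
  by rewrite scaler0; exact: spanned0.
rewrite [c S]mpolyE scaler_suml; apply: spanned_sum => u _.
by rewrite -mul_mpolyC; exact: spanned_monomial.
Qed.

(** A vanishing combination lifts to an element v of the exterior algebra with
    zero boundary.  By [piece_run] its part of each degree a is
    supported on even sets, hence is zero; and the coefficient of that part at
    S is a single coefficient of a single p x. *)
Lemma pieces_free p : (0 < k)%N -> (n < k.+1.*2)%N ->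
  (forall x, poly_in (piece_vars x) (p x)) ->
  \sum_x p x *: piece_gen x = 0 -> forall x, p x = 0.
Proof.
move=> k0 nk pZ p0 x; apply/mpolyP=> w; rewrite mcoeff0.
apply/eqP; apply: contraT => pw.
pose pD z := p z * 'X_[mset (val z).2].
pose v : exterior K n := \sum_z pD z *: ext_basis K (val z).1.
pose a := (w + mset (val x).2 + mset (val x).1)%MM.
have vE S : v S = \sum_(z : pieces | (val z).1 == S) pD z.
  rewrite sum_ffunE [RHS]big_mkcond; apply: eq_bigr => z _.
  by rewrite !ffunE eq_sym; case: eqP => _; rewrite ?scaler0 // /GRing.scale /= mulr1.
have dv : koszul_diff v = 0.
  have /(congr1 val) := p0; rewrite raddf0 raddf_sum => <-.
  rewrite linear_sum; apply: eq_bigr => z _; have /and3P[/eqP zk _ _] := valP z.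
  by rewrite /piece_gen scalerA [RHS](val_scale_gen _ zk) linearZ.
have pDw : (pD x)@_(a - mset (val x).1) = (p x)@_w.
  by rewrite addmK mcoeffMXE lem_addl addmK.
have runx : (val x).2 = run (msupport a) (records (val x).1).
  by apply: piece_run (pZ x) _; rewrite -/(pD x) pDw.
have bd0 : bd (degree_part a v) = 0.
  by rewrite -degree_part_diff dv; apply/ffunP=> S; rewrite !ffunE mcoeff0 if_same.
have even : even_chain (msupport a) k (degree_part a v).
  move=> S; rewrite ffunE; case: ifP => [SA|]; last by rewrite eqxx.
  rewrite vE raddf_sum => /eqP h.
  have [z zS zN] : exists2 z : pieces, (val z).1 = S & (pD z)@_(a - mset S) != 0.
    have [/exists_inP[z /eqP zS zN]|/exists_inPn h'] :=
      boolP [exists (z : pieces | (val z).1 == S), (pD z)@_(a - mset S) != 0].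
      by exists z.
    by case: h; rewrite big1 // => z /h'; rewrite negbK => /eqP.
  have /and3P[/eqP zk _ ez] := valP z; rewrite -zS in zN *; split=> //.
  by rewrite /odd_run -(piece_run (pZ z) zN).
have /ffunP/(_ (val x).1) := even_chain_cycle k0 nk even bd0.
rewrite !ffunE -mset_le lem_addl vE raddf_sum (bigD1 x) //= big1 ?addr0.
  by rewrite pDw => /eqP; rewrite (negbTE pw).
move=> z /andP[/eqP zS zx]; apply: contraNeq zx; rewrite -zS => zN.
apply/eqP/val_inj; have := piece_run (pZ z) zN; rewrite zS -runx => zD.
by rewrite [LHS]surjective_pairing [RHS]surjective_pairing zS zD.
Qed.

End Syzygies.

(** * The upper bound *)

Section Upper.

Variables (K : fieldType) (n k : nat).
Implicit Types (S T : {set 'I_n}).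
Local Notation M := (koszul_syz_module K n k).
Local Notation mpoly := {mpoly K[n]}.

Lemma mcoeffM_deg1 (p q : mpoly) i : p@_0 = 0 -> q@_0 = 0 -> (p * q)@_U_(i) = 0.
Proof.
move=> p0 q0; apply/eqP; rewrite mcoeff_eq0; apply/negP => /msuppM_le.
move=> /allpairsP[[u v] /= [up vq e]].
have nz (r : mpoly) w : r@_0 = 0 -> w \in msupp r -> (0 < mdeg w)%N.
  move=> r0; rewrite lt0n mdeg_eq0; apply: contraTneq => ->.
  by rewrite -mcoeff_eq0 r0.
have := congr1 mdeg e; rewrite mdegD mdeg1.
by have := nz _ _ p0 up; have := nz _ _ q0 vq; lia.
Qed.

Lemma mcoeffMU1 (p : mpoly) i j : (p * 'X_i)@_U_(j) = p@_0 *+ (i == j).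
Proof.
rewrite mcoeffMXE lep1mP mnm1E [j == i]eq_sym; have [->|] := eqVneq i j => //=.
by rewrite -{1}[U_(j)%MM]add0m addmK.
Qed.

Lemma koszul_image_mcoeff0 (y : M) U : (val y U : mpoly)@_0 = 0.
Proof.
have /asboolP[v _ ->] := valP y; rewrite koszul_diffE raddf_sum big1 // => i _.
rewrite /= mcoeffCM mcoeffMXE lep1mP mnm0E mulr0 //.
Qed.

Lemma val_sum_scale (I : finType) (p : I -> mpoly) (y : I -> koszul_syz K n k) U :
  val (\sum_l p l *: y l) U = \sum_l p l * (val (y l) U : mpoly) :> mpoly.
Proof.
have valZ q (z : koszul_syz K n k) : val (q *: z) = q *: val z by exact: linearZ.
rewrite raddf_sum sum_ffunE; apply: eq_bigr => l _.
by rewrite [X in fun_of_fin X]valZ ffunE.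
Qed.

(** Otherwise the generators form a basis of the module, and the coordinates p
    of the g_(T - i) have no constant term: the coefficient of X_i in the
    relation among them isolates the constant term of p i. *)
Lemma stanley_generators_not_basis (D : stanley_family M) :
    (0 < k)%N -> (k < n)%N -> stanley_decomposition D ->
  exists i, sf_set (s := D) i != setT.
Proof.
move=> k0 kn [space dec]; apply/existsP; apply: contraT => /existsPn full.
have pT i (p : mpoly) : poly_in (sf_set (s := D) i) p.
  move=> u _ j; have := full i; rewrite negbK => /eqP ->.
  by rewrite in_setT.
have expand (y : M) : exists p : 'I_(sf_size D) -> mpoly,
    y = \sum_l p l *: sf_gen l.
  have [z [[hz zE] _]] := dec y.
  have /boolp.choice[p hp] : forall l, exists p, z l = p *: sf_gen l.
    by move=> l; have [p _ ?] := hz l; exists p.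
  by exists p; rewrite zE; apply: eq_bigr.
have free (q : 'I_(sf_size D) -> mpoly) :
    \sum_l q l *: sf_gen l = 0 :> M -> forall l, q l = 0.
  move=> q0 l; apply: (space l).2 => //; have [z [_ uz]] := dec 0.
  have E1 : z = [ffun l => q l *: sf_gen l].
    apply: uz; split=> [j|]; first by rewrite ffunE; exists (q j).
    by rewrite -[LHS]q0; apply: eq_bigr => j _; rewrite ffunE.
  have E2 : z = [ffun=> 0].
    apply: uz; split=> [j|]; first by rewrite ffunE; exists 0; rewrite ?scale0r.
    by rewrite big1 // => j _; rewrite ffunE.
  by move: E1; rewrite E2 => /ffunP/(_ l); rewrite !ffunE => ->.
have [T Tk] : exists T, #|T| = k.+1.
  exists [set i : 'I_n | (i < k.+1)%N].
  rewrite -sum1dep_card -[RHS]card_ord -sum1_card (big_ord_widen n (fun=> 1%N)) //.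
have [p hp] := boolp.choice (fun i => expand (koszul_gen K k (T :\ i))).
have p0 i : i \in T -> forall l, (p i l)@_0 = 0.
  move=> iT l; have /free/(_ l) :
      \sum_l (\sum_(j in T) (sg K j T)%:MP * 'X_j * p j l) *: sf_gen l = 0 :> M.
    rewrite -[RHS](koszul_boundary_relation K Tk).
    under [RHS]eq_bigr => j _ do rewrite hp scaler_sumr.
    rewrite exchange_big /=; apply: eq_bigr => h _; rewrite scaler_suml.
    by apply: eq_bigr => j _; rewrite scalerA.
  move=> /(congr1 (mcoeff U_(i))); rewrite mcoeff0 raddf_sum (bigD1 i) //=.
  rewrite big1 ?addr0 => [|j /andP[_ ji]]; rewrite -mulrA [_ * p _ _]mulrC.
    rewrite mcoeffCM mcoeffMU1 eqxx => /(congr1 ( *%R (sg K i T))).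
    by rewrite mulrA sg_sq mul1r mulr0.
  by rewrite mcoeffCM mcoeffMU1 (negbTE ji) mulr0.
(* contradiction: the component of g_(T - t) at T - t - s is +-X_s, but all
   the products in its expansion have order at least 2 *)
have [t tT] : exists t, t \in T by apply/set0Pn; rewrite -card_gt0 Tk.
have Sk : #|T :\ t| = k by have := cardsD1 t T; rewrite tT Tk => -[].
have [s sS] : exists s, s \in T :\ t by apply/set0Pn; rewrite -card_gt0 Sk.
have := congr1 (mcoeff U_(s)) (val_koszul_gen_face K Sk sS).
rewrite hp [X in mcoeff _ X]val_sum_scale raddf_sum big1 => [|l _].
  by rewrite mcoeffCM mcoeffXU eqxx mulr1 => /esym/eqP; rewrite /sg signr_eq0.
exact: mcoeffM_deg1 (p0 _ tT _) (koszul_image_mcoeff0 _ _).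
Qed.

End Upper.

(** * The Stanley depth *)

Lemma sdepth_koszul_syz (K : fieldType) (n k : nat) :
  (0 < k)%N -> (n./2 <= k < n)%N -> sdepth_is (koszul_syz_module K n k) (n - 1)%N.
Proof.
move=> k0 /andP[nk kn].
have upper (D : stanley_family (koszul_syz_module K n k)) :
    stanley_decomposition D -> (stanley_family_depth D <= n - 1)%N.
  move=> /(stanley_generators_not_basis k0 kn)[i iT].
  apply: leq_trans (bigminn_le _ _ i) _.
  have : (#|sf_set (s := D) i| < n)%N.
    by rewrite -[X in (_ < X)%N]card_ord -cardsT proper_card // properT.
  lia.
split=> //; have dec : stanley_decomposition
    (StanleyFamily (fun j : 'I_#|{: pieces n k}| => piece_vars (enum_val j))
                   (fun j => piece_gen K (enum_val j))).
  apply: stanley_decomposition_fin => [x|y|p]; first exact: piece_gen_hom.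
    exact: spanned_all.
  by apply: pieces_free => //; lia.
eexists; first exact: dec.
apply/anti_leq/andP; split; first exact: upper dec.
apply: stanley_family_depth_ge => [|i]; first exact: leq_subr.
exact: card_piece_vars.
Qed.

Lemma sdepth_residue (K : fieldType) : sdepth_is (residue_module K 1) 0.
Proof.
have Z0 (D : stanley_family (residue_module K 1)) :
    stanley_decomposition D -> stanley_family_depth D = 0%N.
  move=> [space dec]; have [z [[_ z1] _]] := dec (1 : K).
  have [l _] : exists l : 'I_(sf_size D), true.
    case: D space dec z z1 => -[|s] Z m _ _ z z1; last by exists ord0.
    by move: z1; rewrite big_ord0 => /eqP; rewrite oner_eq0.
  apply/eqP; rewrite -leqn0; apply: leq_trans (bigminn_le _ _ l) _.
  rewrite leqn0 cards_eq0 -subset0; apply/subsetP => i iZ.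
  have : 'X_i = 0 :> {mpoly K[1]}.
    apply: (space l).2 => [u|].
      rewrite msuppX inE => /eqP -> j; apply: contraNeq.
      by rewrite mnm1E; have [<-|] := eqVneq i j.
    by rewrite /GRing.scale /= /residue_scale mevalXU mul0r.
  by move=> /(congr1 (mcoeff U_(i)))/eqP; rewrite mcoeffXU eqxx mcoeff0 oner_eq0.
split=> [|D /Z0 -> //].
pose one : residue_module K 1 := (1 : K).
have dec : stanley_decomposition
    (StanleyFamily (fun j : 'I_#|{: unit}| => set0) (fun=> one)).
  have pC (p : {mpoly K[1]}) : poly_in set0 p -> p = (p@_0)%:MP.
    move=> hp; apply/mpolyP=> u; rewrite mcoeffC.
    have [->|u0] := eqVneq u 0%MM; first by rewrite mulr1.
    apply/eqP; rewrite mulr0 mcoeff_eq0; apply: contra u0 => /hp h.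
    by apply/eqP/mnmP => i; rewrite mnm0E h // in_set0.
  have sE (p : {mpoly K[1]}) : p *: one = p.@[fun=> 0] :> K.
    by rewrite /GRing.scale /= /residue_scale mulr1.
  have sum1 (F : unit -> residue_module K 1) : \sum_i F i = F tt.
    by rewrite (bigD1 tt) //= big1 ?addr0 // => -[].
  apply: (@stanley_decomposition_fin K 1 _ unit (fun=> set0) (fun=> one)).
  - by move=> _; exists 0; rewrite /ghom /= /residue_hom eqxx.
  - move=> x; exists (fun=> (x : K)%:MP).
      move=> _ u; rewrite msuppC; case: eqP => // _; rewrite inE => /eqP -> i _.
      exact: mnm0E.
    by rewrite sum1 sE mevalC.
  - move=> p pZ; rewrite sum1 sE => p0 []; move: p0.
    by rewrite (pC _ (pZ tt)) mevalC => ->.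
by eexists; [exact: dec | exact: Z0].
Qed.

Theorem theorem1p1 (K : fieldType) (n k : nat)
  (hn : (1 <= n)%N) (hk : (n./2 <= k < n)%N) :
  sdepth_is (syzygy K n k) (n - 1)%N.
Proof.
case: k hk => [|k] hk; last exact: sdepth_koszul_syz.
have -> : n = 1%N by lia.
exact: sdepth_residue.
Qed.
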